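(* Let $m,d,\tau,d_{\mathrm t}>0$, let $\Delta P>0$, $\Delta\omega_{\mathrm d}>0$, $\cos\psi_{\mathrm d}\in(0,1]$ with $\psi_{\mathrm d}\in[0,\pi/2)$, and $\alpha_{\mathrm d}>0$. Consider the power network under the proportionality assumption with representative generator $\hat g_{\mathrm o}(s)=\frac{\tau s+1}{m\tau s^2+(m+d\tau)s+d+d_{\mathrm t}}$ and frequency shaping control $\hat c_{\mathrm o}(s)=\hat c_{\mathrm{fs}}(s)=\frac{d_{\mathrm t}}{\tau s+1}-(d_{\mathrm b}+d_{\mathrm t})$. Define $$d_{\mathrm b,\mathrm{osc}}=\max\left(0,\;2\sqrt{\lambda_n m}\cos\psi_{\mathrm d}-d-d_{\mathrm t},\;2m\alpha_{\mathrm d}-d-d_{\mathrm t}\right),$$ $$d_{\mathrm b,\mathrm{COI}}=\max\left(0,\;\frac{\Delta P}{(\sum_{i=1}^n r_i)\Delta\omega_{\mathrm d}}-d-d_{\mathrm t}\right).$$ Suppose that $d_{\mathrm b,\mathrm{osc}}\in[0,\,2\sqrt{\lambda_2 m}-d-d_{\mathrm t})$ and $d_{\mathrm b,\mathrm{COI}}\in[0,\,(m\alpha_{\mathrm d}^2+\lambda_2)/\alpha_{\mathrm d}-d-d_{\mathrm t})$, and choose $$d_{\mathrm b}=\max(d_{\mathrm b,\mathrm{COI}},d_{\mathrm b,\mathrm{osc}}).$$ Then: (Frequency security) for every step disturbance $\boldsymbol p=\boldsymbol u_0\mathds{1}_{t\ge0}$ with $|\sum_{i=1}^n u_{0,i}|\le\Delta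 P$, the COI frequency deviation satisfies $\max_{t\ge0}|\bar\omega_{\mathrm{fs}}(t)|\le\Delta\omega_{\mathrm d}$ (with the maximum read as a supremum); (Oscillatory stability) for every $k\in\{2,\dots,n\}$, $\hat z_{k,\mathrm{fs}}(s)$ is $(\alpha_{\mathrm d},\psi_{\mathrm d})$-stable.
   Context: Power network model: $n\ge2$ buses, connected network; $\boldsymbol L_{\mathrm B}\in\mathbb R^{n\times n}$ is its undirected weighted Laplacian (symmetric, positive semidefinite, kernel spanned by the all-ones vector). Proportionality assumption: there are $r_i>0$ such that bus $i$ has generator transfer function $\hat g_i=\hat g_{\mathrm o}/r_i$ and inverter transfer function $\hat c_i=r_i\hat c_{\mathrm o}$. With $\boldsymbol R=\mathrm{diag}(r_1,\dots,r_n)$, the scaled Laplacian $\boldsymbol L=\boldsymbol R^{-1/2}\boldsymbol L_{\mathrm B}\boldsymbol R^{-1/2}$ has eigenvalues $0=\lambda_1<\lambda_2\le\dots\le\lambda_n$. For $k\in\{1,\dots,n\}$, $$\hat z_{k,\mathrm{fs}}(s)=\frac{\hat g_{\mathrm o}(s)}{1+\hat g_{\mathrm o}(s)(\lambda_k/s-\hat c_{\mathrm{fs}}(s))}.$$ Under a step disturbance $\boldsymbol p=\boldsymbol u_0\mathds{1}_{t\ge0}$ ($\mathds{1}_{t\ge0}$ the unit step), the COI frequency deviation is $\bar\omega_{\mathrm{fs}}(t)=\frac{\sum_i u_{0,i}}{\sum_i r_i}z_{\mathrm u,1,\mathrm{fs}}(t)$, where $z_{\mathrm u,1,\mathrm{fs}}(t)$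 is the inverse Laplace transform of $\hat z_{1,\mathrm{fs}}(s)/s$. $(\alpha,\psi)$-stability, for $\alpha>0$ and $\psi\in[0,\pi/2)$: a system is $(\alpha,\psi)$-stable if all its poles (after cancellation of common factors) lie in the region $\mathcal S_{\alpha,\psi}$ of complex $s$ with $\mathrm{Re}(s)\le-\alpha$ (decay rate at least $\alpha$) and $-\mathrm{Re}(s)/|s|\ge\cos\psi$ (damping ratio at least $\cos\psi$). *)

(* Defs.v *)
From HB Require Import structures.
From mathcomp Require Import all_boot all_order all_algebra.
From mathcomp Require Import all_classical all_reals all_analysis.
From mathcomp Require Import complex.

Set Implicit Arguments.
Unset Strict Implicit.
Unset Printing Implicit Defensive.

Import Order.TTheory GRing.Theory Num.Theory.
Import numFieldNormedType.Exports.

Local Open Scope classical_set_scope.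
Local Open Scope ring_scope.
Local Open Scope complex_scope.

Notation "x %:F" := (FracField.tofrac x) : ring_scope.

Definition tf (R : realType) := {fraction {poly R[i]}}.

Definition tf_const (R : realType) (a : R) : tf R := ((a%:C)%:P)%:F.

Definition tf_s (R : realType) : tf R := ('X : {poly R[i]})%:F.

(* [F] takes the finite value [v] at the complex point [s]. *)
Definition tf_value (R : realType) (F : tf R) (s v : R[i]) : Prop :=
  exists p q : {poly R[i]},
    [/\ q.[s] != 0, F = p%:F / q%:F & v = p.[s] / q.[s]].

Definition tf_pole (R : realType) (F : tf R) (s : R[i]) : Prop :=
  exists p q : {poly R[i]},
    [/\ q != 0, coprimep p q, F = p%:F / q%:F & root q s].

(* [complex.Re `|s|] is the modulus as a real number: the norm of R[i] is
   R[i]-valued.  For [0 < alpha] the region excludes 0, where the damping ratio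
   would be the junk value 0 / 0. *)
Definition stability_region (R : realType) (alpha psi : R) : set R[i] :=
  [set s | complex.Re s <= - alpha /\
           cos psi <= - complex.Re s / complex.Re `|s| ].

Definition alpha_psi_stable (R : realType) (alpha psi : R) (F : tf R) : Prop :=
  forall s : R[i], tf_pole F s -> stability_region alpha psi s.

Definition cexp (R : realType) (z : R[i]) : R[i] :=
  (expR (complex.Re z))%:C * (cos (complex.Im z) +i* sin (complex.Im z)).

Definition laplace (R : realType) (f : R -> R) (s : R[i]) : R[i] :=
  (\int[@lebesgue_measure R]_(t in `[0, +oo[)
      complex.Re (cexp (- s * t%:C) * (f t)%:C))
  +i*
  (\int[@lebesgue_measure R]_(t in `[0, +oo[)
      complex.Im (cexp (- s * t%:C) * (f t)%:C)).

(* [f] is the inverse Laplace transform of [F].  The transform determines [f]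
   only almost everywhere; continuity on [0, +oo[ selects the usual
   representative, so that pointwise statements about [f] make sense. *)
Definition inverse_laplace (R : realType) (F : tf R) (f : R -> R) : Prop :=
  {within `[0, +oo[, continuous f} /\
  exists sigma : R, forall s : R[i], sigma < complex.Re s ->
    (@lebesgue_measure R).-integrable `[0, +oo[
       (fun t => (expR (- complex.Re s * t) * f t)%:E) /\
    tf_value F s (laplace f s).

Definition weighted_laplacian (R : realType) (n : nat)
    (w : 'I_n -> 'I_n -> R) : 'M[R]_n :=
  \matrix_(i, j) (if i == j then \sum_(k < n | k != i) w i k else - w i j).

(* The lines are the pairs of distinct buses of nonzero weight.  For positive
   line weights the last two clauses follow from the others; they are stated
   so that the sign of an individual weight need not be restricted. *)
Definition network_laplacian (R : realType) (n : nat) (LB : 'M[R]_n) : Prop :=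
  exists w : 'I_n -> 'I_n -> R,
    [/\ forall i j, w i j = w j i,
        forall i j, connect (fun k l => (k != l) && (w k l != 0)) i j,
        LB = weighted_laplacian w,
        forall x : 'cV[R]_n, 0 <= (x^T *m LB *m x) 0 0
      & forall x : 'cV[R]_n, LB *m x = 0 <-> exists a : R, x = const_mx a].

Definition scaled_laplacian (R : realType) (n : nat) (LB : 'M[R]_n)
    (r : 'I_n -> R) : 'M[R]_n :=
  let Rmhalf := diag_mx (\row_i (Num.sqrt (r i))^-1) in
  Rmhalf *m LB *m Rmhalf.

(* [lam 1 <= ... <= lam n] are the eigenvalues of [A] with multiplicity; the
   other values of [lam] are irrelevant. *)
Definition sorted_eigenvalues (R : realType) (n : nat) (A : 'M[R]_n)
    (lam : nat -> R) : Prop :=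
  char_poly A = \prod_(1 <= k < n.+1) ('X - (lam k)%:P) /\
  forall i j : nat, (1 <= i <= j)%N -> (j <= n)%N -> lam i <= lam j.

Definition proportional_buses (R : realType) (n : nat) (r : 'I_n -> R)
    (go co : tf R) (g c : 'I_n -> tf R) : Prop :=
  forall i, [/\ 0 < r i, g i = go / tf_const (r i) & c i = tf_const (r i) * co].

Definition tf_generator (R : realType) (m d tau dt : R) : tf R :=
  (tf_const tau * tf_s R + 1) /
  (tf_const (m * tau) * tf_s R ^+ 2 + tf_const (m + d * tau) * tf_s R +
   tf_const (d + dt)).

Definition tf_freq_shaping (R : realType) (tau dt db : R) : tf R :=
  tf_const dt / (tf_const tau * tf_s R + 1) - tf_const (db + dt).

Definition tf_mode (R : realType) (go c : tf R) (lamk : R) : tf R :=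
  go / (1 + go * (tf_const lamk / tf_s R - c)).

(* [zu] is the step response of the first mode, i.e. the inverse Laplace
   transform of its transfer function divided by s. *)
Definition coi_freq_dev (R : realType) (n : nat) (r u0 : 'I_n -> R)
    (zu : R -> R) (t : R) : R :=
  (\sum_i u0 i) / (\sum_i r i) * zu t.

Definition db_osc (R : realType) (m d dt lamn psid alphad : R) : R :=
  Num.max 0 (Num.max (2 * Num.sqrt (lamn * m) * cos psid - d - dt)
                     (2 * m * alphad - d - dt)).

Definition db_coi (R : realType) (n : nat) (d dt : R) (r : 'I_n -> R)
    (DeltaP Deltaw : R) : R :=
  Num.max 0 (DeltaP / ((\sum_i r i) * Deltaw) - d - dt).

(* Main.v *)
(* Cancelling the pole of the shaping filter leaves the second-order modes
   s / (m s^2 + D s + lam_k) with D = d + dt + db, and lam_1 = 0 because the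
   Laplacian is singular while lam_2 > 0.  For k >= 2 the bounds on db place
   both roots in the region, whether the mode is underdamped or not.  For
   k = 1 the step response must be (1 - exp (- D t / m)) / D, by injectivity of
   the Laplace transform on continuous functions; it is at most 1 / D. *)

Require Import Defs.
From HB Require Import structures.
From mathcomp Require Import all_boot all_order all_algebra.
From mathcomp Require Import all_classical all_reals all_analysis.
From mathcomp Require Import complex.
From mathcomp Require Import ring lra.

Set Implicit Arguments.
Unset Strict Implicit.
Unset Printing Implicit Defensive.

Import Order.TTheory GRing.Theory Num.Theory.
Import numFieldNormedType.Exports.

Local Open Scope classical_set_scope.
Local Open Scope ring_scope.
Local Open Scope complex_scope.

(** * Algebra of the modal transfer functions *)

(* Multiplying out, 1 / go - c = m s + d + db + dt: the factor tau s + 1 cancels. *)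
Lemma mode_fraction (F : fieldType) (s m d tau dt db l : F) :
  let go := (tau * s + 1) / (m * tau * s ^+ 2 + (m + d * tau) * s + (d + dt)) in
  let c := dt / (tau * s + 1) - (db + dt) in
  let den := m * s ^+ 2 + (d + dt + db) * s + l in
  s != 0 -> tau * s + 1 != 0 ->
  m * tau * s ^+ 2 + (m + d * tau) * s + (d + dt) != 0 -> den != 0 ->
  go / (1 + go * (l / s - c)) = s / den.
Proof.
move=> go c den s0 ts0 gd0 den0.
have -> : 1 + go * (l / s - c) =
    den * (tau * s + 1) /
    (s * (m * tau * s ^+ 2 + (m + d * tau) * s + (d + dt))).
  by rewrite /go /c /den; field; rewrite gd0 s0 ts0.
rewrite /go; move: den den0 => {c}{}den den0.
by field; rewrite den0 gd0 s0 ts0.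
Qed.

Definition mode_poly (R : realType) (m D l : R) : {poly R[i]} :=
  m%:C *: 'X^2 + D%:C *: 'X + (l%:C)%:P.

Lemma coef_mode_poly (R : realType) (m D l : R) :
  [/\ (mode_poly m D l)`_0 = l%:C, (mode_poly m D l)`_1 = D%:C
    & (mode_poly m D l)`_2 = m%:C].
Proof.
by split; rewrite /mode_poly !coefD !coefZ coefC coefX coefXn/=
  ?mulr1 ?mulr0 ?addr0 ?add0r.
Qed.

Lemma mode_polyE (R : realType) (m D l : R) :
  (mode_poly m D l)%:F =
  tf_const m * tf_s R ^+ 2 + tf_const D * tf_s R + tf_const l.
Proof.
by rewrite /mode_poly -!mul_polyC !expr2 !rmorphD/= !rmorphM.
Qed.

Lemma horner_mode_poly (R : realType) (m D l : R) (s : R[i]) :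
  (mode_poly m D l).[s] = m%:C * s ^+ 2 + D%:C * s + l%:C.
Proof. by rewrite /mode_poly !hornerE. Qed.

(** A disjunction, so that the degenerate case [tau s + 1], whose quadratic coefficient is zero, is
    covered along with the true quadratics. *)
Lemma mode_poly_neq0 (R : realType) (m D l : R) :
  0 < m \/ 0 < D \/ 0 < l -> mode_poly m D l != 0.
Proof.
have [e0 e1 e2] := coef_mode_poly m D l.
move=> h; apply/eqP => p0; move: e0 e1 e2.
by rewrite p0 !coef0 => -[l0] [D0] [m0]; move: h; rewrite -l0 -D0 -m0 !ltxx => -[|[]].
Qed.

Lemma tf_modeE (R : realType) (m d tau dt db l : R) :
  0 < m -> 0 < d -> 0 < tau -> 0 < dt ->
  tf_mode (tf_generator m d tau dt) (tf_freq_shaping tau dt db) l =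
  ('X : {poly R[i]})%:F / (mode_poly m (d + dt + db) l)%:F.
Proof.
move=> hm hd htau hdt.
have cD (a b : R) : tf_const (a + b) = tf_const a + tf_const b.
  by rewrite /tf_const !rmorphD.
have cM (a b : R) : tf_const (a * b) = tf_const a * tf_const b.
  by rewrite /tf_const !rmorphM.
have c1 : tf_const (1 : R) = 1.
  by rewrite /tf_const (rmorph1 (real_complex R)) polyC1 tofrac1.
have c0 : tf_const (0 : R) = 0.
  by rewrite /tf_const (rmorph0 (real_complex R)) polyC0 tofrac0.
have nz (a b c : R) : 0 < a \/ 0 < b \/ 0 < c ->
    tf_const a * tf_s R ^+ 2 + tf_const b * tf_s R + tf_const c != 0.
  by move=> h; rewrite -mode_polyE tofrac_eq0 mode_poly_neq0.
rewrite /tf_mode /tf_generator /tf_freq_shaping mode_polyE.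
have := nz 0 tau 1 (or_intror (or_introl htau)).
have := nz (m * tau) (m + d * tau) (d + dt) (or_introl (mulr_gt0 hm htau)).
have := nz m (d + dt + db) l (or_introl hm).
rewrite !(cD, cM) c0 c1 mul0r add0r => n1 n2 n3.
have : tf_s R != 0 by rewrite tofrac_eq0 polyX_eq0.
rewrite -/(tf_s R); move: n1 n2 n3.
move: (tf_const m) (tf_const d) (tf_const tau) (tf_const dt) (tf_const db).
move: (tf_const l) (tf_s R) => l' s m' d' tau' dt' db' n1 n2 n3 s0.
have h := @mode_fraction (tf R) s m' d' tau' dt' db' l'.
exact: h s0 n3 n2 n1.
Qed.

(** Equating the coprime fraction [p / q] with the reduced mode gives [X q = p * mode_poly]. At a
    root of [q] the left side vanishes while [p] does not, so [mode_poly] does. *)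
Lemma tf_mode_pole (R : realType) (m d tau dt db l : R) (s : R[i]) :
  0 < m -> 0 < d -> 0 < tau -> 0 < dt ->
  tf_pole (tf_mode (tf_generator m d tau dt) (tf_freq_shaping tau dt db) l) s ->
  m%:C * s ^+ 2 + (d + dt + db)%:C * s + l%:C = 0.
Proof.
move=> hm hd htau hdt [p [q [q0 pq]]]; rewrite tf_modeE// => /eqP.
rewrite eqr_div ?tofrac_eq0 ?mode_poly_neq0//; last by left.
rewrite -!rmorphM tofrac_eq => /eqP e /[dup] rq /rootP qs.
have /eqP := congr1 (horner^~ s) e; rewrite !hornerM qs mulr0 eq_sym mulf_eq0.
rewrite (negbTE (_ : p.[s] != 0)) /=; first by rewrite horner_mode_poly => /eqP.
by apply/eqP => /rootP; apply/negP; apply: coprimep_root rq; rewrite coprimep_sym.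
Qed.

(** With zero eigenvalue the factor [s] of the mode cancels the [1 / s] of the step. The product
    form also yields that [s (m s + D)] is nonzero wherever the value is finite. *)
Lemma mode_step_value (R : realType) (m d tau dt db : R) (s v : R[i]) :
  0 < m -> 0 < d -> 0 < tau -> 0 < dt ->
  tf_value (tf_mode (tf_generator m d tau dt) (tf_freq_shaping tau dt db) 0
            / tf_s R) s v ->
  v * (s * (m%:C * s + (d + dt + db)%:C)) = 1.
Proof.
move=> hm hd htau hdt [p [q [qs]]]; rewrite tf_modeE// => /eqP e ->.
have s0 : tf_s R != 0 by rewrite tofrac_eq0 polyX_eq0.
move: e; rewrite mulrAC divff// mul1r -[_^-1]mul1r -tofrac1.
rewrite eqr_div ?tofrac_eq0 ?mode_poly_neq0//; [|by left|]; last first.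
  by apply: contraNN qs => /eqP ->; rewrite horner0.
rewrite -!rmorphM tofrac_eq mul1r => /eqP /(congr1 (horner^~ s)).
rewrite hornerM horner_mode_poly => e.
have {}e : p.[s] * (s * (m%:C * s + (d + dt + db)%:C)) = q.[s].
  by rewrite e; congr (_ * _); rewrite addr0; ring.
by rewrite mulrAC e divff.
Qed.

(** * Root location for the second-order modes *)

Lemma quadratic_root_region (R : realType) (m D l alpha psi : R) (s : R[i]) :
  0 < m -> 0 < l -> 0 < alpha ->
  2 * m * alpha <= D -> D * alpha < m * alpha ^+ 2 + l ->
  2 * Num.sqrt (l * m) * cos psi <= D ->
  m%:C * s ^+ 2 + D%:C * s + l%:C = 0 -> stability_region alpha psi s.
Proof.
case: s => x y hm hl ha hD1 hD2 hD3 /eqP.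
rewrite expr2; simpc; rewrite eq_complex /= => /andP[/eqP e1 /eqP e2].
have {}e1 : m * (x * x - y * y) + D * x + l = 0 by rewrite -e1; ring.
have {}e2 : y * (2 * m * x + D) = 0 by rewrite -e2; ring.
rewrite /stability_region /=.
have [y0|y0] := eqVneq y 0.
- have {}e1 : m * x * x + D * x + l = 0 by rewrite -e1 y0; ring.
  have D0 : 0 < D by apply: lt_le_trans hD1; rewrite !mulr_gt0.
  have x0 : x < 0.
    rewrite ltNge; apply/negP => x0.
    have := mulr_ge0 (mulr_ge0 (ltW hm) x0) x0; have := mulr_ge0 (ltW D0) x0; lra.
  split.
    (* For [P(x) = m x^2 + D x + l], the product of [x + alpha] and [m (x - alpha) + D] is
       [P(x) - P(- alpha)]. At a root it equals [- P(- alpha) < 0], yet for [x > - alpha] both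
       factors are positive, the second because [D >= 2 m alpha]. *)
    rewrite leNgt; apply/negP => xa.
    have h1 : 0 < x + alpha by lra.
    have h2 : 0 < m * (x - alpha) + D.
      by have := mulr_gt0 hm h1; lra.
    by have := mulr_gt0 h1 h2; lra.
  by rewrite y0 expr0n addr0 sqrtr_sqr ltr0_norm// divff ?cos_le1// oppr_eq0 lt_eqF.
(* Nonreal roots have real part [- D / (2 m)] and squared modulus [l / m], so their damping ratio is
   [D / (2 sqrt (l m))]. *)
- have {}e2 : D = - 2 * m * x.
    move/eqP: e2; rewrite mulf_eq0 (negbTE y0) /= => /eqP; lra.
  have e3 : l = m * (x ^+ 2 + y ^+ 2) by move: e1; rewrite e2; lra.
  have n0 : 0 < x ^+ 2 + y ^+ 2.
    by rewrite ltr_wpDl ?sqr_ge0// exprn_even_gt0.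
  split.
    by rewrite -(ler_pM2l hm); lra.
  rewrite ler_pdivlMr ?sqrtr_gt0// -(ler_pM2l hm).
  have : Num.sqrt (l * m) = m * Num.sqrt (x ^+ 2 + y ^+ 2).
    rewrite e3 mulrAC -expr2 sqrtrM ?sqr_ge0// sqrtr_sqr ger0_norm//; exact: ltW.
  move: hD3 => /[swap] ->; lra.
Qed.

(** * The zero eigenvalue of the scaled Laplacian *)

(** The row of the [sqrt (r i)] is a left null vector: the first scaling turns it into the all-ones
    row, which the symmetric [LB] annihilates. *)
Lemma scaled_laplacian_char_root0 (R : realType) (n : nat) (LB : 'M[R]_n)
    (r : 'I_n -> R) :
  (0 < n)%N -> network_laplacian LB -> (forall i, 0 < r i) ->
  root (char_poly (scaled_laplacian LB r)) 0.
Proof.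
case: n LB r => // n LB r _ [w [ws _ LBw _ ker]] r0.
have LBT : LB^T = LB.
  by apply/matrixP => i j; rewrite LBw !mxE eq_sym ws; case: eqP => // ->.
rewrite -eigenvalue_root_char; apply/eigenvalueP.
exists (\row_i Num.sqrt (r i)); last first.
  apply/eqP => /rowP /(_ ord0); rewrite !mxE => /eqP.
  by rewrite gt_eqF// sqrtr_gt0.
rewrite scale0r /scaled_laplacian !mulmxA.
have -> : (\row_i Num.sqrt (r i)) *m diag_mx (\row_i (Num.sqrt (r i))^-1)
    = (const_mx 1)^T.
  apply/rowP => i; rewrite mul_mx_diag !mxE divff// gt_eqF// sqrtr_gt0//.
rewrite -LBT -trmx_mul.
have -> : LB *m (const_mx 1 : 'cV_n.+1) = 0 by apply/ker; exists 1.
by rewrite trmx0 mul0mx.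
Qed.

(** Zero is some [lam k], and [k >= 2] would force [lam k >= lam 2 > 0]. *)
Lemma sorted_eigenvalue1_eq0 (R : realType) (n : nat) (A : 'M[R]_n)
    (lam : nat -> R) :
  root (char_poly A) 0 -> sorted_eigenvalues A lam -> 0 < lam 2%N -> lam 1%N = 0.
Proof.
move=> rA [cA mono] l2; move: rA; rewrite cA /root horner_prod.
rewrite prodf_seq_eq0 => /hasP[k]; rewrite mem_index_iota => /andP[k1 kn] /=.
rewrite !hornerE oppr_eq0 => /eqP lk0.
move: k1; rewrite leq_eqVlt => /predU1P[->//|k2].
by have := mono 2%N k k2 kn; rewrite lk0 leNgt l2.
Qed.

(** * Injectivity of the Laplace transform on continuous functions *)

(* Test G against the N-th powers of the quadratic 1 + delta^2 - (x - x0)^2 in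
   x = exp (- t), which exceeds 1 exactly for |x - x0| < delta. *)
Lemma moments_zero_le0 (R : realType) (G : R -> R) :
  let mu := @lebesgue_measure R in
  {within `[0, +oo[, continuous G} ->
  mu.-integrable `[0, +oo[ (EFin \o G) ->
  (forall p : {poly R},
    mu.-integrable `[0, +oo[ (EFin \o (fun t => p.[expR (- t)] * G t)) /\
    \int[mu]_(t in `[0, +oo[) (p.[expR (- t)] * G t) = 0) ->
  forall t, 0 <= t -> G t <= 0.
Proof.
move=> mu Gc Gi hp t0 t00; rewrite leNgt; apply/negP => G0.
pose c := G t0 / 2.
have c0 : 0 < c by rewrite divr_gt0.
have [eta eta0 Gc'] : exists2 eta : R, 0 < eta &
    forall t, 0 <= t -> `|t - t0| < eta -> c < G t.
  have : \forall t \near within `[0, +oo[ (nbhs t0), c < G t.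
    have : G x @[x --> within `[0, +oo[ (nbhs t0)] --> G t0.
      by move/subspace_continuousP: Gc; apply; rewrite /= in_itv/= t00.
    by move=> /cvgr_gt; apply; rewrite /c ltr_pdivrMr// mulr_natr mulr2n ltrDl.
  rewrite /within /= => /nbhs_ballP[e /= e0 he]; exists e; [exact: e0|].
  move=> t tp te; have := he t; rewrite /ball /=.
  by rewrite in_itv /= andbT distrC; apply.
(* In the variable [x = exp (- t)], [dl] is the distance from [x0] to the image of [t0 + eta]. *)
pose x0 := expR (- t0); pose dl := x0 - expR (- (t0 + eta)).
have x00 : 0 < x0 := expR_gt0 _.
have x01 : x0 <= 1 by rewrite -expR0 ler_expR oppr_le0.
have dlE : dl = x0 * (1 - expR (- eta)).
  by rewrite /dl opprD expRD mulrBr mulr1.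
have e1 : 0 < 1 - expR (- eta) by rewrite subr_gt0 -expR0 ltr_expR oppr_lt0.
have dl0 : 0 < dl by rewrite dlE mulr_gt0.
have dleta : dl <= eta.
  have := expR_ge1Dx (- eta) => h; rewrite dlE.
  apply: le_trans (_ : 1 - expR (- eta) <= _); last by lra.
  by rewrite ger_pMl.
have far t : `|t - t0| >= eta -> `|expR (- t) - x0| >= dl.
  rewrite ler_normr => /orP[h|h].
    rewrite distrC ler_normr; apply/orP; left.
    by rewrite lerB// ler_expR; lra.
  rewrite ler_normr; apply/orP; left.
  have : expR (- (t0 - eta)) <= expR (- t) by rewrite ler_expR; lra.
  (* On the side [t <= t0 - eta] the distance is at least [x0 (E - 1)] with [E = exp eta], which is
     no less than [dl = x0 (1 - 1 / E)] because [E + 1 / E >= 2]. *)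
  rewrite opprB addrC expRD -/x0 dlE.
  have : 1 + eta <= expR eta := expR_ge1Dx _.
  have := expR_ge1Dx (- eta); rewrite expRN.
  set E := expR eta => h1 h2 h3.
  have E0 : 0 < E := expR_gt0 _.
  have h4 : E + E^-1 >= 2.
    have : E * (E + E^-1 - 2) = (E - 1) ^+ 2 by field; lra.
    by move=> h5; have := sqr_ge0 (E - 1); rewrite -h5 pmulr_rge0//; lra.
  by have := ler_wpM2l (ltW x00) h4; lra.
pose p : {poly R} := (1 + dl ^+ 2)%:P - ('X - x0%:P) ^+ 2.
have pE x : p.[x] = 1 + dl ^+ 2 - (x - x0) ^+ 2.
  by rewrite /p !hornerE.
have ex01 t : 0 <= t -> 0 < expR (- t) <= 1.
  by move=> tp; rewrite expR_gt0 -expR0 ler_expR oppr_le0.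
have pge0 t : 0 <= t -> 0 <= p.[expR (- t)].
  move=> /ex01 /andP[h1 h2]; rewrite pE.
  have : (expR (- t) - x0) ^+ 2 <= 1.
    have h3 : 0 <= 1 - (expR (- t) - x0) by lra.
    have h4 : 0 <= 1 + (expR (- t) - x0) by lra.
    by have := mulr_ge0 h3 h4; lra.
  by have := sqr_ge0 dl; lra.
(* [I] lies to the right of [t0], hence in the half-line even when [t0 = 0]. There
   [|x - x0| <= t - t0 <= dl / 2], so [p >= 1 + 3 dl^2 / 4 >= q]; and [dl <= eta] keeps [G > c] on
   [I]. *)
pose I := `[t0, t0 + dl / 2]%classic : set R.
pose q := 1 + dl ^+ 2 / 2.
have pq t : I t -> q <= p.[expR (- t)].
  rewrite /I /= in_itv/= => /andP[h1 h2]; rewrite pE /q.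
  have : `|expR (- t) - x0| <= dl / 2.
    rewrite distrC ger0_norm; last by rewrite subr_ge0 ler_expR lerN2.
    have -> : expR (- t) = x0 * expR (- (t - t0)).
      by rewrite /x0 -expRD; congr expR; ring.
    have h := expR_ge1Dx (- (t - t0)).
    have := ler_wpM2l (ltW x00) h.
    have h3 : 0 <= t - t0 by rewrite subr_ge0.
    have := ler_wpM2r h3 x01.
    lra.
  rewrite ler_norml => /andP[h3 h4].
  have h5 : 0 <= dl / 2 - (expR (- t) - x0) by lra.
  have h6 : 0 <= dl / 2 + (expR (- t) - x0) by lra.
  by have := mulr_ge0 h5 h6; have := sqr_ge0 dl; lra.
have q1 : 1 <= q by rewrite /q lerDl divr_ge0// sqr_ge0.
have mI : measurable I by exact: measurable_itv.
have muI : mu I = (dl / 2)%:E.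
  rewrite /mu /I lebesgue_measure_itv /= lte_fin ltrDl divr_gt0//.
  by rewrite -EFinB; congr EFin; ring.
have mD : measurable (`[0, +oo[ : set (g_sigma_algebraType R.-ocitv.-measurable)).
  exact: measurable_itv.
have Idom : I `<=` `[0, +oo[.
  by move=> t; rewrite /I /= !in_itv/= andbT => /andP[h _]; exact: le_trans h.
(* Three zones: on [I] the product is at least [q^N c]; elsewhere within [eta] of [t0] it is
   nonnegative; farther away [0 <= p <= 1], so it is at least [- |G|]. *)
have ptw N t : `[0, +oo[%classic t ->
    q ^+ N * c * \1_I t - `|G t| <= (p ^+ N).[expR (- t)] * G t.
  rewrite /= in_itv/= andbT => tp; rewrite horner_exp.
  have qN0 : 0 <= q ^+ N by rewrite exprn_ge0//; lra.
  have pN0 : 0 <= p.[expR (- t)] ^+ N by rewrite exprn_ge0// pge0.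
  rewrite indicE; case: (boolP (t \in I)) => [|_].
    rewrite inE => It; rewrite mulr1.
    have Gt : c < G t.
      apply: Gc' => //; move: It; rewrite /I /= in_itv/= => /andP[h1 h2].
      rewrite ger0_norm; lra.
    apply: le_trans (_ : q ^+ N * c <= _); first by rewrite gerBl.
    apply: ler_pM => //; [exact: ltW| |exact: ltW].
    by apply: lerXn2r; rewrite ?nnegrE ?pge0 ?pq//; lra.
  rewrite mulr0 sub0r.
  have [near|/far dist] := ltP `|t - t0| eta.
    have Gt := Gc' t tp near.
    apply: le_trans (_ : 0 <= _); first by rewrite oppr_le0.
    by rewrite mulr_ge0//; lra.
  have : `|p.[expR (- t)] ^+ N * G t| <= `|G t|.
    rewrite normrM ler_piMl// ger0_norm// exprn_ile1// ?pge0// pE.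
    have : dl ^+ 2 <= (expR (- t) - x0) ^+ 2.
      by rewrite -(real_normK (num_real (_ - x0))) lerXn2r ?nnegrE//; lra.
    by lra.
  by rewrite ler_norml => /andP[].
have nGi := integrable_norm Gi.
have Ii : mu.-integrable `[0, +oo[ (EFin \o \1_I).
  apply: (@integrableS _ _ _ mu setT) => //; exact: integrable_indic_itv.
have intI : \int[mu]_(t in `[0, +oo[) \1_I t = dl / 2.
  by rewrite /Rintegral integral_indic// setIidl// [X in fine X]muI.
pose K := \int[mu]_(t in `[0, +oo[) `|G t|.
(* Integrate the minorant: the moment of [p^N] is zero, so the mass on [I] is at most the L1 norm
   [K] of [G]. *)
have bound N : q ^+ N * c * (dl / 2) <= K.
  have [pi p0] := hp (p ^+ N).
  have Zi : mu.-integrable `[0, +oo[ (EFin \o (fun t => q ^+ N * c * \1_I t)).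
    exact: (integrableZl _ (q ^+ N * c) Ii).
  have Bi : mu.-integrable `[0, +oo[
      (EFin \o (fun t => q ^+ N * c * \1_I t - `|G t|)).
    exact: (integrableB _ Zi nGi).
  have := le_Rintegral mD Bi pi (ptw N).
  by rewrite p0 RintegralB// RintegralZl// intI subr_le0.
have ep : 0 < dl ^+ 2 / 2 by rewrite divr_gt0// exprn_gt0.
have A0 : 0 < c * (dl / 2) * (dl ^+ 2 / 2) by rewrite !mulr_gt0// divr_gt0.
have [N hN] : exists N : nat, K < c * (dl / 2) * (dl ^+ 2 / 2) * N%:R.
  have := archi_boundP (_ : 0 <= `|K| / (c * (dl / 2) * (dl ^+ 2 / 2))).
  rewrite divr_ge0// ?ltW// => /(_ isT); rewrite ltr_pdivrMr// => h.
  by exists (Num.bound (`|K| / (c * (dl / 2) * (dl ^+ 2 / 2))));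
    apply: le_lt_trans (ler_norm _) _; rewrite mulrC.
(* Bernoulli's inequality: [q^N] grows at least linearly in [N], contradicting the uniform bound
   [K]. *)
have bern : 1 + dl ^+ 2 / 2 *+ N <= q ^+ N.
  elim: N {hN} => [|N IH]; first by rewrite mulr0n addr0 expr0.
  rewrite [q ^+ _]exprS mulrS.
  apply: le_trans (ler_wpM2l (le_trans ler01 q1) IH).
  have : 0 <= dl ^+ 2 / 2 * (dl ^+ 2 / 2 *+ N) by rewrite mulr_ge0 ?mulrn_wge0 ?ltW.
  by rewrite /q; lra.
have cd0 : 0 < c * (dl / 2) by rewrite mulr_gt0// divr_gt0.
have := bound N; have := ler_wpM2l (ltW cd0) bern.
by rewrite -[_ *+ N]mulr_natr; lra.
Qed.

(** Set [G t = exp (- s0 t) f t]. A factor [exp (- k t)] moves the transform from [s0] to [s0 + k],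
    so every polynomial moment of [G] in [exp (- t)] vanishes. *)
Lemma laplace_zero_le0 (R : realType) (f : R -> R) (s0 : R) :
  let mu := @lebesgue_measure R in
  {within `[0, +oo[, continuous f} ->
  (forall s, s0 <= s ->
    mu.-integrable `[0, +oo[ (EFin \o (fun t => expR (- s * t) * f t)) /\
    \int[mu]_(t in `[0, +oo[) (expR (- s * t) * f t) = 0) ->
  forall t, 0 <= t -> f t <= 0.
Proof.
move=> mu fc hf t t0.
rewrite -(pmulr_rle0 _ (expR_gt0 (- s0 * t))).
have mD : measurable (`[0, +oo[ : set (g_sigma_algebraType R.-ocitv.-measurable)).
  exact: measurable_itv.
move: t t0; apply: (@moments_zero_le0 R (fun t => expR (- s0 * t) * f t)).
- apply/subspace_continuousP => x x0; apply: cvgM.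
    apply: cvg_within_filter.
    apply: continuous_comp; last exact: continuous_expR.
    by apply: continuousM => //; exact: cst_continuous.
  by move/subspace_continuousP: fc; apply.
- by have [] := hf s0 (lexx _).
(* The shift [k] is generalized for the induction: the factor ['X] in [p * 'X + c] is absorbed as
   [k.+1]. *)
have key (p : {poly R}) : forall k : nat,
    mu.-integrable `[0, +oo[
      (EFin \o (fun t => p.[expR (- t)] * (expR (- (s0 + k%:R) * t) * f t))) /\
    \int[mu]_(t in `[0, +oo[)
      (p.[expR (- t)] * (expR (- (s0 + k%:R) * t) * f t)) = 0.
  elim/poly_ind: p => [|p c IH] k.
    have -> : (fun t => 0.[expR (- t)] * (expR (- (s0 + k%:R) * t) * f t))
        = cst 0.
      by apply/funext => t; rewrite horner0 mul0r.
    by split; [exact: integrable0 | rewrite Rintegral_cst// mul0r].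
  have [i1 v1] := IH k.+1.
  have [|i2 v2] := hf (s0 + k%:R); first by rewrite lerDl.
  have -> : (fun t => (p * 'X + c%:P).[expR (- t)] *
                      (expR (- (s0 + k%:R) * t) * f t)) =
      (fun t => p.[expR (- t)] * (expR (- (s0 + k.+1%:R) * t) * f t) +
                c * (expR (- (s0 + k%:R) * t) * f t)).
    have E (t : R) : - (s0 + k.+1%:R) * t = - t + - (s0 + k%:R) * t.
      by rewrite -natr1; ring.
    apply/funext => t; rewrite hornerMXaddC E expRD; ring.
  have i3 : mu.-integrable `[0, +oo[
      (EFin \o (fun t => c * (expR (- (s0 + k%:R) * t) * f t))).
    exact: (integrableZl _ c i2).
  split; first exact: (integrableD _ i1 i3).
  by rewrite RintegralD// RintegralZl// v1 v2 mulr0 addr0.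
by move=> p; have := key p 0%N; rewrite addr0.
Qed.

Lemma laplace_zero (R : realType) (f : R -> R) (s0 : R) :
  let mu := @lebesgue_measure R in
  {within `[0, +oo[, continuous f} ->
  (forall s, s0 <= s ->
    mu.-integrable `[0, +oo[ (EFin \o (fun t => expR (- s * t) * f t)) /\
    \int[mu]_(t in `[0, +oo[) (expR (- s * t) * f t) = 0) ->
  forall t, 0 <= t -> f t = 0.
Proof.
move=> mu fc hf t t0; apply/le_anti/andP; split.
  exact: (laplace_zero_le0 fc hf).
rewrite -oppr_le0; move: t t0; apply: (@laplace_zero_le0 R (\- f) s0).
  apply/subspace_continuousP => x x0; apply: cvgN.
  by move/subspace_continuousP: fc; apply.
have mD : measurable (`[0, +oo[ : set (g_sigma_algebraType R.-ocitv.-measurable)).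
  exact: measurable_itv.
move=> s /hf[i v].
have -> : (fun t => expR (- s * t) * (\- f) t) =
    (fun t => -1 * (expR (- s * t) * f t)).
  by apply/funext => t; rewrite mulN1r mulrN.
split; first exact: (integrableZl _ (-1) i).
by rewrite RintegralZl// v mulr0.
Qed.

(** * Step response of the first mode *)

(** The exponential density of rate [a] has total mass one; divide by [a]. *)
Lemma integral_expR (R : realType) (a : R) :
  let mu := @lebesgue_measure R in 0 < a ->
  mu.-integrable `[0, +oo[ (EFin \o (fun t => expR (- a * t))) /\
  \int[mu]_(t in `[0, +oo[) expR (- a * t) = a^-1.
Proof.
move=> mu a0.
have mD : measurable (`[0, +oo[ : set (g_sigma_algebraType R.-ocitv.-measurable)).
  exact: measurable_itv.
have i : mu.-integrable `[0, +oo[ (EFin \o (fun t => a * expR (- a * t))).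
  apply/integrable_mkcond => //; rewrite restrict_EFin.
  exact: integrable_exponential_pdf.
have v : \int[mu]_(t in `[0, +oo[) (a * expR (- a * t)) = 1.
  by rewrite Rintegral_mkcond /Rintegral integral_exponential_pdf.
have -> : (fun t => expR (- a * t)) = (fun t => a^-1 * (a * expR (- a * t))).
  by apply/funext => t; rewrite mulKf// gt_eqF.
split; first exact: (integrableZl _ a^-1 i).
by rewrite RintegralZl// v mulr1.
Qed.

(** By partial fractions, [1 / (s (m s + D)) = (1 / s - 1 / (s + D / m)) / D], so [f] and the
    candidate have equal transforms and their difference vanishes. *)
Lemma first_order_step_response (R : realType) (m D : R) (f : R -> R) (s0 : R) :
  let mu := @lebesgue_measure R in
  0 < m -> 0 < D -> 0 < s0 ->
  {within `[0, +oo[, continuous f} ->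
  (forall s, s0 <= s ->
    mu.-integrable `[0, +oo[ (EFin \o (fun t => expR (- s * t) * f t)) /\
    \int[mu]_(t in `[0, +oo[) (expR (- s * t) * f t) = (s * (m * s + D))^-1) ->
  forall t, 0 <= t -> f t = D^-1 * (1 - expR (- (D / m) * t)).
Proof.
move=> mu hm hD hs0 fc hf t t0; apply/eqP; rewrite -subr_eq0; apply/eqP.
have mD : measurable (`[0, +oo[ : set (g_sigma_algebraType R.-ocitv.-measurable)).
  exact: measurable_itv.
pose y t := D^-1 * (1 - expR (- (D / m) * t)).
move: t t0; apply: (@laplace_zero R (fun t => f t - y t) s0).
  apply/subspace_continuousP => x x0; apply: cvgB.
    by move/subspace_continuousP: fc; apply.
  apply: cvg_within_filter; apply: cvgM; first exact: cvg_cst.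
  apply: cvgB; first exact: cvg_cst.
  apply: continuous_comp; last exact: continuous_expR.
  by apply: continuousM => //; exact: cst_continuous.
move=> s ss0; have s_gt0 : 0 < s by exact: lt_le_trans ss0.
have [i v] := hf s ss0.
have [i1 v1] := integral_expR s_gt0.
have [|i2 v2] := @integral_expR R (s + D / m).
  by rewrite addr_gt0// divr_gt0.
have -> : (fun t => expR (- s * t) * (f t - y t)) =
    (fun t => expR (- s * t) * f t -
      D^-1 * (expR (- s * t) - expR (- (s + D / m) * t))).
  have E (t : R) : - (s + D / m) * t = - s * t + - (D / m) * t by ring.
  by apply/funext => t; rewrite /y E expRD; ring.
have i3 : mu.-integrable `[0, +oo[
    (EFin \o (fun t => expR (- s * t) - expR (- (s + D / m) * t))).
  exact: (integrableB _ i1 i2).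
have i4 : mu.-integrable `[0, +oo[ (EFin \o (fun t =>
    D^-1 * (expR (- s * t) - expR (- (s + D / m) * t)))).
  exact: (integrableZl _ D^-1 i3).
split; first exact: (integrableB _ i i4).
rewrite RintegralB// RintegralZl// RintegralB// v v1 v2; field.
by rewrite !gt_eqF// addr_gt0// mulr_gt0.
Qed.

(** Links the complex transform to the real integrals on which the uniqueness argument runs. *)
Lemma Re_laplace_real (R : realType) (f : R -> R) (s : R) :
  complex.Re (laplace f s%:C) =
  \int[@lebesgue_measure R]_(t in `[0, +oo[) (expR (- s * t) * f t).
Proof.
rewrite /laplace /=; apply: eq_Rintegral => t _.
by rewrite /cexp /= !(mulr0, mul0r, oppr0, addr0, subr0, cos0, mulr1).
Qed.

(** * Frequency security and oscillatory stability of the network *)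

Theorem mainTheorem4 (R : realType) (n : nat) (hn : (2 <= n)%N)
  (LB : 'M[R]_n) (hLB : network_laplacian LB)
  (r : 'I_n -> R) (lam : nat -> R)
  (hlam : sorted_eigenvalues (scaled_laplacian LB r) lam)
  (m d tau dt : R) (hm : 0 < m) (hd : 0 < d) (htau : 0 < tau) (hdt : 0 < dt)
  (DeltaP Deltaw psid alphad : R)
  (hDeltaP : 0 < DeltaP) (hDeltaw : 0 < Deltaw)
  (hpsid : 0 <= psid < pi / 2) (halphad : 0 < alphad)
  (db : R)
  (hdb : db = Num.max (db_coi d dt r DeltaP Deltaw)
                      (db_osc m d dt (lam n) psid alphad))
  (g c : 'I_n -> tf R)
  (hbus : proportional_buses r (tf_generator m d tau dt)
            (tf_freq_shaping tau dt db) g c)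
  (hosc : 0 <= db_osc m d dt (lam n) psid alphad
            < 2 * Num.sqrt (lam 2%N * m) - d - dt)
  (hcoi : 0 <= db_coi d dt r DeltaP Deltaw
            < (m * alphad ^+ 2 + lam 2%N) / alphad - d - dt) :
  let zfs (k : nat) :=
    tf_mode (tf_generator m d tau dt) (tf_freq_shaping tau dt db) (lam k) in
  (forall (zu1 : R -> R) (u0 : 'I_n -> R),
     inverse_laplace (zfs 1%N / tf_s R) zu1 ->
     `|\sum_i u0 i| <= DeltaP ->
     (ereal_sup [set `|coi_freq_dev r u0 zu1 t|%:E | t in [set t : R | (0 <= t)%R]]
        <= Deltaw%:E)%E)
  /\
  (forall k : nat, (2 <= k <= n)%N -> alpha_psi_stable alphad psid (zfs k)).
Proof.
move=> zfs.
have r0 i : 0 < r i by have [] := hbus i.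
have n0 : (0 < n)%N by apply: leq_trans hn.
pose D := d + dt + db.
have shift A : A - d - dt <= db -> A <= D by rewrite /D; lra.
have S0 : 0 < \sum_i r i.
  rewrite (bigD1 (Ordinal n0)) //= ltr_pwDl// sumr_ge0// => i _; exact: ltW.
have D_coi : DeltaP / ((\sum_i r i) * Deltaw) <= D.
  have : db_coi d dt r DeltaP Deltaw <= db by rewrite hdb le_max lexx.
  by rewrite /db_coi ge_max => /andP[_ /shift].
have db_osc_le : db_osc m d dt (lam n) psid alphad <= db.
  by rewrite hdb le_max lexx orbT.
move: (db_osc_le); rewrite /db_osc !ge_max => /and3P[db0 D_psi D_alpha].
have D0 : 0 < D by rewrite /D ltr_wpDr// addr_gt0.
(* The interval assumed for [db_osc] is nonempty, so [2 sqrt (lam_2 m) > d + dt > 0]. *)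
have l2 : 0 < lam 2%N.
  case/andP: hosc => o0 o1.
  have : 0 < Num.sqrt (lam 2%N * m) by lra.
  by rewrite sqrtr_gt0 pmulr_lgt0.
have l1 : lam 1%N = 0.
  apply: sorted_eigenvalue1_eq0 hlam l2.
  exact: scaled_laplacian_char_root0.
have D_lt : D * alphad < m * alphad ^+ 2 + lam 2%N.
  (* [db] is a maximum of two terms. The bound on [db_coi] is already the wanted one; the bound
     [2 sqrt (lam_2 m)] coming from [db_osc] implies it by the arithmetic-geometric mean
     inequality. *)
  have amgm : 2 * Num.sqrt (lam 2%N * m) * alphad <= m * alphad ^+ 2 + lam 2%N.
    have sm := sqr_sqrtr (ltW hm); have sl := sqr_sqrtr (ltW l2).
    rewrite (sqrtrM _ (ltW l2)) -{2}sm -{2}sl.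
    by have := sqr_ge0 (Num.sqrt m * alphad - Num.sqrt (lam 2%N)); lra.
  rewrite -ltr_pdivlMr// /D hdb -ltrBrDl gt_max; apply/andP; split.
    by case/andP: hcoi => _; lra.
  case/andP: hosc => _ /lt_le_trans; apply.
  by rewrite -subr_ge0 opprB; move: amgm; rewrite -ler_pdivlMr//; lra.
split.
  move=> zu u0 [zc [sigma hz]] hu.
  have zuE t : 0 <= t -> zu t = D^-1 * (1 - expR (- (D / m) * t)).
    (* The threshold must be positive and lie strictly beyond the abscissa [sigma]. *)
    move: t; apply: (@first_order_step_response _ _ _ _ (Num.max sigma 0 + 1)) => //.
      by rewrite ltr_wpDl// le_max lexx orbT.
    move=> s hs.
    have ssig : sigma < s.
      apply: lt_le_trans hs; rewrite ltr_pwDr// le_max lexx//.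
    have s0 : 0 < s.
      by apply: lt_le_trans hs; rewrite ltr_wpDl// le_max lexx orbT.
    have [zi zv] := hz s%:C ssig; split; first exact: zi.
    move: zv; rewrite /zfs l1 => /mode_step_value -/(_ hm hd htau hdt).
    rewrite -/D -Re_laplace_real -!rmorphM -rmorphD -rmorphM => /(congr1 (@complex.Re R)).
    case: (laplace _ _) => a b /=; rewrite mulr0 subr0 => e.
    have k0 : 0 < s * (m * s + D) by rewrite mulr_gt0// addr_gt0// mulr_gt0.
    by apply: (mulIf (lt0r_neq0 k0)); rewrite e mulVf// gt_eqF.
  apply: ge_ereal_sup => _ [t /= t0 <-]; rewrite lee_fin /coi_freq_dev zuE//.
  rewrite !normrM !normfV (gtr0_norm S0) (gtr0_norm D0).
  have E1 : `|1 - expR (- (D / m) * t)| <= 1.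
    have e1 : expR (- (D / m) * t) <= 1.
      by rewrite -expR0 ler_expR mulNr oppr_le0 mulr_ge0// divr_ge0 ?ltW.
    by rewrite ger0_norm; have := expR_gt0 (- (D / m) * t); lra.
  (* The step response is at most [1 / D], and [D_coi] turns [DeltaP / (D * sum of r)] into a
     quantity below [Deltaw]. *)
  apply: le_trans (_ : DeltaP / (\sum_i r i) * (D^-1 * 1) <= _).
    apply: ler_pM => //; first by rewrite divr_ge0// ltW.
    - by rewrite mulr_ge0// invr_ge0 ltW.
    - by rewrite ler_pM2r ?invr_gt0.
    - by rewrite ler_pM2l ?invr_gt0.
  rewrite mulr1 ler_pdivrMr// [Deltaw * D]mulrC -ler_pdivrMr//.
  by rewrite -mulrA -invfM.
move=> k /andP[k2 kn] s pole.
have [_ mono] := hlam.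
(* The decay condition is tightest at [lam_2] and the damping condition at [lam_n], so the two
   extreme eigenvalues control every mode. *)
have lk : lam 2%N <= lam k by apply: mono.
have lkn : lam k <= lam n by apply: mono => //; rewrite (leq_trans _ k2).
have lk0 : 0 < lam k by exact: lt_le_trans lk.
have cos0 : 0 <= cos psid.
  by apply: cos_ge0_pihalf; case/andP: hpsid => p0 p1; lra.
apply: (quadratic_root_region hm lk0 halphad _ _ _ (tf_mode_pole hm hd htau hdt pole)).
- exact: shift.
- by apply: lt_le_trans D_lt _; rewrite lerD2l.
- apply: le_trans (_ : 2 * Num.sqrt (lam n * m) * cos psid <= _).
    rewrite ler_wpM2r// ler_pM2l// ler_wsqrtr// ler_pM2r//.
  exact: shift.
Qed.
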